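(* There exists a rank-one torsion-free atomic monoid $M$ such that the monoid algebra $R[M]$ is not atomic for any integral domain $R$.
   Context: All monoids are commutative and cancellative, and are written additively when used as exponents. The difference group (Grothendieck group) of a monoid $M$ is denoted $\mathrm{gp}(M)$. The monoid $M$ is torsion-free if $\mathrm{gp}(M)$ is a torsion-free group, and the rank of $M$ is the rank of $\mathrm{gp}(M)$ as a $\mathbb{Z}$-module, i.e. $\dim_{\mathbb{Q}}(\mathbb{Q}\otimes_{\mathbb{Z}}\mathrm{gp}(M))$. An atom of $M$ is a non-invertible element $a$ such that $a=b+c$ with $b,c\in M$ implies that $b$ or $c$ is invertible. The monoid $M$ is atomic if every non-invertible element of $M$ is a sum of finitely many atoms (repetitions allowed). An integral domain is atomic if its multiplicative monoid of nonzero elements is atomic, i.e. every nonzero nonunit is a finite product of irreducibles. For a commutative ring $R$ with identity and a monoid $M$, the monoid algebra $R[M]$ is the commutative ring of all polynomial expressions $r_1X^{q_1}+\cdots+r_kX^{q_k}$ with coefficients $r_i\in R$ and exponents $q_i\in M$. It is an integral domain when $R$ is an integral domain and $M$ is torsion-free. *)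

(* Defs.v *)
From HB Require Import structures.
From mathcomp Require Import all_boot all_order all_algebra.
From mathcomp Require Import generic_quotient finmap monalg.

Set Implicit Arguments.
Unset Strict Implicit.
Unset Printing Implicit Defensive.

Import GRing.Theory.
Local Open Scope ring_scope.
Local Open Scope quotient_scope.

HB.mixin Record Nmodule_isCancellative M of GRing.Nmodule M := {
  cancel_addrI : right_injective (@GRing.add M)
}.

#[short(type="cancelNmodType")]
HB.structure Definition CancelNmodule :=
  { M of GRing.Nmodule M & Nmodule_isCancellative M }.

Section MonoidAtomicity.
Variable M : nmodType.

Definition invertible_elt (x : M) : Prop := exists y, x + y = 0.

Definition atom (a : M) : Prop :=
  ~ invertible_elt a /\
  forall b c, a = b + c -> invertible_elt b \/ invertible_elt c.

Definition atomic_monoid : Prop :=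
  forall x : M, ~ invertible_elt x ->
  exists s : seq M, (forall a, a \in s -> atom a) /\ x = \sum_(a <- s) a.

End MonoidAtomicity.

(* The difference group gp M: classes of pairs (a, b), standing for a - b,   *)
(* with (a, b) ~ (c, d) iff a + d = c + b; cancellation is what makes this   *)
(* relation transitive.                                                      *)

Section DifferenceGroup.
Variable M : cancelNmodType.
Implicit Types x y : M * M.

Definition gp_rel x y := x.1 + y.2 == y.1 + x.2.

Fact gp_rel_refl : reflexive gp_rel.
Proof. by move=> x; rewrite /gp_rel. Qed.

Fact gp_rel_sym : symmetric gp_rel.
Proof. by move=> x y; rewrite /gp_rel eq_sym. Qed.

Fact gp_rel_trans : transitive gp_rel.
Proof.
move=> y x z /eqP xy /eqP yz; apply/eqP; apply: (@cancel_addrI _ y.2).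
by rewrite addrCA addrA xy addrAC yz addrAC addrC.
Qed.

Canonical gp_equiv := EquivRel gp_rel gp_rel_refl gp_rel_sym gp_rel_trans.

Definition gp := {eq_quot gp_equiv}.

HB.instance Definition _ := EqQuotient.on gp.
HB.instance Definition _ := Choice.on gp.

Lemma gp_eqP x y : reflect (x.1 + y.2 = y.1 + x.2) (\pi_gp x == \pi_gp y).
Proof. by rewrite eqmodE; apply: eqP. Qed.

Definition gp_zero : gp := \pi_gp (0, 0).
Definition gp_opp := lift_op1 gp (fun x => (x.2, x.1)).
Definition gp_add := lift_op2 gp (fun x y => (x.1 + y.1, x.2 + y.2)).

Fact pi_gp_opp : {morph \pi_gp : x / (x.2, x.1) >-> gp_opp x}.
Proof.
move=> x; unlock gp_opp; apply/eqP/gp_eqP => /=.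
have /eqP/gp_eqP e : \pi_gp (repr (\pi_gp x)) = \pi_gp x by rewrite reprK.
by rewrite addrC [RHS]addrC e.
Qed.
Canonical pi_gp_opp_morph := PiMorph1 pi_gp_opp.

Fact pi_gp_add :
  {morph \pi_gp : x y / (x.1 + y.1, x.2 + y.2) >-> gp_add x y}.
Proof.
move=> x y; unlock gp_add; apply/eqP/gp_eqP => /=.
have /eqP/gp_eqP ex : \pi_gp (repr (\pi_gp x)) = \pi_gp x by rewrite reprK.
have /eqP/gp_eqP ey : \pi_gp (repr (\pi_gp y)) = \pi_gp y by rewrite reprK.
by rewrite addrACA -ex -ey addrACA.
Qed.
Canonical pi_gp_add_morph := PiMorph2 pi_gp_add.

Fact gp_addA : associative gp_add.
Proof.
by elim/quotW=> x; elim/quotW=> y; elim/quotW=> z; rewrite !piE /= !addrA.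
Qed.

Fact gp_addC : commutative gp_add.
Proof.
elim/quotW=> x; elim/quotW=> y; rewrite !piE /=.
by rewrite [y.1 + _]addrC [y.2 + _]addrC.
Qed.

Fact gp_add0 : left_id gp_zero gp_add.
Proof. by elim/quotW=> -[a b]; rewrite /gp_zero !piE /= !add0r. Qed.

Fact gp_addN : left_inverse gp_zero gp_opp gp_add.
Proof.
elim/quotW=> -[a b]; rewrite /gp_zero !piE /=.
by apply/eqP/gp_eqP => /=; rewrite addr0 add0r addrC.
Qed.

HB.instance Definition _ :=
  GRing.isZmodule.Build gp gp_addA gp_addC gp_add0 gp_addN.

Lemma gp_addE x y :
  \pi_gp x + \pi_gp y = \pi_gp (x.1 + y.1, x.2 + y.2) :> gp.
Proof. by rewrite -[LHS]/(gp_add _ _) !piE. Qed.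

End DifferenceGroup.

Definition torsion_free_group (G : zmodType) : Prop :=
  forall (x : G) (n : nat), (0 < n)%N -> x *+ n = 0 -> x = 0.

Definition biadditive (A B C : zmodType) (b : A -> B -> C) : Prop :=
  (forall x, {morph b x : y z / y + z}) /\
  (forall y, {morph b^~ y : x z / x + z}).

(* V, with t q g in the role of the pure tensor, is the tensor product of    *)
(* rat and G over the integers, with rat acting on the left factor.  For     *)
(* maps out of rat and G, being Z-balanced follows from biadditivity.        *)
Definition is_rat_tensor (G : zmodType) (V : lmodType rat)
    (t : rat -> G -> V) : Prop :=
  [/\ biadditive t,
      forall q r g, t (q * r) g = q *: t r g
    & forall (W : zmodType) (b : rat -> G -> W), biadditive b ->
      exists f : {additive V -> W}, (forall q g, f (t q g) = b q g) /\
        forall f' : {additive V -> W}, (forall q g, f' (t q g) = b q g) ->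
        f' =1 f].

(* Only finite ranks are covered: a vectType is finite dimensional. *)
Definition group_rank (G : zmodType) (n : nat) : Prop :=
  exists (V : vectType rat) (t : rat -> G -> V),
    is_rat_tensor t /\ \dim {:V} = n.

Definition torsion_free_monoid (M : cancelNmodType) : Prop :=
  torsion_free_group (gp M).

Definition monoid_rank (M : cancelNmodType) (n : nat) : Prop :=
  group_rank (gp M) n.

(* The additive group of R[M] is {malg R[M]}, the finitely supported         *)
(* functions M -> R.  The library's own product on {malg R[M]} is not used:  *)
(* it requires a monomType, in which 0 is the only invertible      *)
(* element, and this is not part of the definition of a monoid here.         *)

Definition monoid_algebra (R : comNzRingType) (M : nmodType) : Type :=
  {malg R[M]}.

HB.instance Definition _ (R : comNzRingType) (M : nmodType) :=
  GRing.Lmodule.copy (monoid_algebra R M) {malg R[M]}.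

Section MonoidAlgebra.
Variables (R : comNzRingType) (M : nmodType).
Implicit Types f g h : {malg R[M]}.

Definition ma_one : {malg R[M]} := << 1 *g 0%R >>.

Definition ma_mul f g : {malg R[M]} :=
  \sum_(p <- msupp f) \sum_(q <- msupp g) << f@_p * g@_q *g (p + q)%R >>.

Lemma ma_mulw (d1 d2 : {fset M}) f g :
  (msupp f `<=` d1)%fset -> (msupp g `<=` d2)%fset ->
  ma_mul f g =
  \sum_(p <- d1) \sum_(q <- d2) << f@_p * g@_q *g (p + q)%R >>.
Proof.
move=> le1 le2; rewrite /ma_mul (big_fset_incl _ le1) /=.
  apply: eq_bigr => p _; apply: big_fset_incl => // q _ /mcoeff_outdom ->.
  by rewrite mulr0 monalgU0.
move=> p _ /mcoeff_outdom fp.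
by rewrite big1 // => q _; rewrite fp mul0r monalgU0.
Qed.

Lemma ma_mulUU (r s : R) (p q : M) :
  ma_mul << r *g p >> << s *g q >> = << r * s *g (p + q)%R >>.
Proof. by rewrite (ma_mulw msuppU_le msuppU_le) !big_seq_fset1 !mcoeffUU. Qed.

Fact ma_mulC : commutative ma_mul.
Proof.
move=> f g; rewrite /ma_mul exchange_big /=.
by apply: eq_bigr => q _; apply: eq_bigr => p _; rewrite mulrC addrC.
Qed.

Fact ma_mulDl : left_distributive ma_mul +%R.
Proof.
move=> f g h.
rewrite (ma_mulw (msuppD_le f g) (fsubset_refl _)).
rewrite (ma_mulw (fsubsetUl _ (msupp g)) (fsubset_refl (msupp h))).
rewrite (ma_mulw (fsubsetUr (msupp f) _) (fsubset_refl (msupp h))).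
rewrite -big_split; apply: eq_bigr => p _.
rewrite -big_split; apply: eq_bigr => q _ /=.
by rewrite mcoeffD mulrDl monalgUD.
Qed.

Fact ma_mul0l : left_zero 0 ma_mul.
Proof. by move=> f; rewrite /ma_mul msupp0 big_seq_fset0. Qed.

Fact ma_mul1l : left_id ma_one ma_mul.
Proof.
move=> f; rewrite (ma_mulw msuppU_le (fsubset_refl _)) big_seq_fset1.
rewrite [RHS]monalgE; apply: eq_bigr => q _.
by rewrite mcoeffUU mul1r add0r.
Qed.

Fact ma_mulA : associative ma_mul.
Proof.
have sumL (s : seq M) (F : M -> {malg R[M]}) g :
    ma_mul (\sum_(p <- s) F p) g = \sum_(p <- s) ma_mul (F p) g.
  exact: (big_morph (ma_mul^~ g) (fun _ _ => ma_mulDl _ _ _) (ma_mul0l g)).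
have sumR (s : seq M) (F : M -> {malg R[M]}) g :
    ma_mul g (\sum_(p <- s) F p) = \sum_(p <- s) ma_mul g (F p).
  by rewrite ma_mulC sumL; apply: eq_bigr => p _; rewrite ma_mulC.
move: ma_mul ma_mulUU sumL sumR => mul mulUU sumL sumR f g h.
rewrite (monalgE f) !sumL; apply: eq_bigr => p _.
rewrite (monalgE g) !(sumL, sumR); apply: eq_bigr => q _.
rewrite (monalgE h) !sumR; apply: eq_bigr => r _.
by rewrite !mulUU mulrA addrA.
Qed.

Fact ma_one_neq0 : ma_one != 0.
Proof. by rewrite monalgU_eq0 oner_eq0. Qed.

HB.instance Definition _ := GRing.Zmodule_isComNzRing.Build
  (monoid_algebra R M) ma_mulA ma_mulC ma_mul1l ma_mulDl ma_one_neq0.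

Lemma monoid_algebra_mulE (f g : monoid_algebra R M) : f * g = ma_mul f g.
Proof. by []. Qed.

End MonoidAlgebra.

Section RingAtomicity.
Variable A : comNzRingType.

Definition ring_unit (x : A) : Prop := exists y, x * y = 1.

Definition ring_irreducible (a : A) : Prop :=
  [/\ a <> 0, ~ ring_unit a
    & forall b c, a = b * c -> ring_unit b \/ ring_unit c].

Definition atomic_ring : Prop :=
  forall x : A, x <> 0 -> ~ ring_unit x ->
  exists s : seq A,
    (forall a, a \in s -> ring_irreducible a) /\ x = \prod_(a <- s) a.

End RingAtomicity.

(* Main.v *)
Require Import Defs.
From HB Require Import structures.
From mathcomp Require Import all_boot all_order all_algebra.
From mathcomp Require Import generic_quotient finmap monalg zify ring lra.
From mathcomp Require Import boolp.

(* Let M_oo be the monoid with atoms H_n, G_n, E_n and relations              *)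
(*   2 H_n = E_n + 2 H_(n+1)   and   3 G_n = E_n + 3 G_(n+1).                 *)
(* Its difference group is free on H_0, G_0 and elements w_n with E_n = 6 w_n,*)
(* and H_m = H_0 - 3 (w_0 + ... + w_(m-1)), G_m = G_0 - 2 (w_0 + ... + w_(m-1)).*)
(* The elements 2 H_0 and 3 G_0 have no maximal common divisor, and their     *)
(* difference is primitive, so in any factorization of X^(2 H_0) + X^(3 G_0)  *)
(* all factors but one are monomials; the remaining factor is always divisible*)
(* by X^(E_n) for n large, hence is never irreducible.                        *)
(*   M is the image of M_oo in the rationals under H_0 := 4, G_0 := 3 and     *)
(* w_n := 2^-(n+4) + 2^-((n+5)^2).  The second summand gives w_n a            *)
(* denominator so much larger than that of w_(n-1) that M_oo -> M is          *)
(* injective over the elements of M that are at most 9 = 3 G_0.  As X^8 + X^9 *)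
(* has degree 9, its factorizations in R[M] are those of R[M_oo].             *)

Set Implicit Arguments.
Unset Strict Implicit.
Unset Printing Implicit Defensive.

Import Order.TTheory GRing.Theory Num.Theory.
Local Open Scope ring_scope.
Local Open Scope quotient_scope.

(** * Digit expansions *)

(** The relations let 2 H_i shed E_i, E_(i+1), ... one after another, and likewise 3 G_i, so no
    common divisor of 8 = 2 H_0 and 9 = 3 G_0 uses up what they share. A polynomial is called
    [special] if its exponents have the invariants of such a pair, up to a common divisor. Three
    facts refute atomicity: X^8 + X^9 is special ([special_binomial]); if a product is special, so
    is one of its factors ([special_mul]); a special polynomial is a multiple of some X^(E_N) with
    non-unit cofactor, so it is not irreducible ([special_dvd], [special_reducible]).

    The invariants of a sum of generators are the number of H's, the number of G's, and for each n
    the coefficient of w_n, called a digit. A value at most 9 determines all of them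
    ([gens_val_inj]): the digits are too small to compensate for the growth of the denominators of
    the w_n ([gens_digit_bound], [w_digits_eq0]). They are therefore additive coordinates on M below
    9, and since leading exponents add over a domain, the factors of a polynomial of degree at most
    9 stay in that range.

    The same invariants show that each generator is an atom ([gen_val_indecomposable]), so M is
    atomic. Torsion-freeness and rank one hold because M is a nonzero submonoid of the rationals. *)

Definition hpow (k : nat) : rat := (2 ^+ k)^-1.

Lemma hpow_gt0 k : 0 < hpow k.
Proof. by rewrite invr_gt0 exprn_gt0. Qed.

Lemma hpowS k : hpow k = 2 * hpow k.+1.
Proof. by rewrite /hpow exprS invfM mulrA divff // mul1r. Qed.

Lemma hpowD k l : hpow (k + l) = hpow k * hpow l.
Proof. by rewrite /hpow exprD invfM. Qed.

Lemma exp_mul_hpow k l : (l <= k)%N -> 2 ^+ k * hpow l = 2 ^+ (k - l).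
Proof. by move=> lk; rewrite -{1}(subnK lk) exprD mulfK // expf_neq0. Qed.

Lemma hpow_anti k l : (k <= l)%N -> hpow l <= hpow k.
Proof.
by move=> /subnKC<-; rewrite hpowD ger_pMr ?hpow_gt0 // invf_le1 ?exprn_gt0 // exprn_ege1.
Qed.

Definition w (n : nat) : rat := hpow (n + 4) + hpow ((n + 5) ^ 2).

Lemma w_ge n : hpow (n + 4) <= w n.
Proof. by rewrite lerDl ltW ?hpow_gt0. Qed.

Lemma w_gt0 n : 0 < w n.
Proof. exact: lt_le_trans (hpow_gt0 _) (w_ge n). Qed.

Lemma w_le n : w n <= hpow (n + 3).
Proof.
rewrite (hpowS (n + 3)) -addnS mulrDl mul1r lerD2l hpow_anti //; nia.
Qed.

Definition wsum (m : nat) : rat := \sum_(n < m) w n.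

Lemma wsumS m : wsum m.+1 = wsum m + w m.
Proof. by rewrite /wsum big_ord_recr. Qed.

Lemma wsum_ge0 m : 0 <= wsum m.
Proof. by apply: sumr_ge0 => i _; apply/ltW/w_gt0. Qed.

Lemma wsum_le m : wsum m <= 1 / 4.
Proof.
(* Strengthened so that induction works: [w m] is at most [hpow (m + 3)], half of the slack
   [hpow (m + 2)]. *)
suff: wsum m + hpow (m + 2) <= 1 / 4.
  by apply: le_trans; rewrite lerDl ltW ?hpow_gt0.
elim: m => [|m IH]; first by rewrite /wsum big_ord0.
rewrite wsumS; have := w_le m; move: IH; rewrite (hpowS (m + 2)) -addnS addSnnS; lra.
Qed.

(* The denominator of [w n] is at least [2 ^+ (2 * n + 9)] times that of       *)
(* [w n.-1], hence the digits [d n] of such an expansion are unique.           *)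
Lemma w_digits_eq0 (N : nat) (d : nat -> int) (z : int) :
  (forall n, (n < N)%N -> `|d n| < 2 ^+ (2 * n + 9)) ->
  z%:~R + \sum_(n < N) (d n)%:~R * w n = 0 -> forall n, (n < N)%N -> d n = 0.
Proof.
elim: N => // N IH bd.
rewrite big_ord_recr /= => eq0.
have dN0 : d N = 0.
  (* The factor 2^((N+4)^2) clears the denominators of all w_n with n < N. *)
  have [z' hz'] : exists z' : int,
      2 ^+ ((N + 4) ^ 2) * (z%:~R + \sum_(n < N) (d n)%:~R * w n) = z'%:~R.
    have : (2 ^+ ((N + 4) ^ 2) * (z%:~R + \sum_(n < N) (d n)%:~R * w n)) \is a Num.int.
      rewrite mulrDr rpredD //; first by rewrite rpredM ?rpredX ?natr_int ?intr_int.
      rewrite mulr_sumr rpred_sum // => n _.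
      rewrite mulrCA rpredM ?intr_int // mulrDr rpredD //.
        have le1 : (n + 4 <= (N + 4) ^ 2)%N by have := ltn_ord n; nia.
        by rewrite (exp_mul_hpow le1) rpredX ?natr_int.
      have le1 : ((n + 5) ^ 2 <= (N + 4) ^ 2)%N by have := ltn_ord n; nia.
      by rewrite (exp_mul_hpow le1) rpredX ?natr_int.
    by move=> /intrP[z' ->]; exists z'.
  have e5 : ((N + 5) ^ 2 = (N + 4) ^ 2 + (2 * N + 9))%N by nia.
  have : (2 ^+ (2 * N + 9) * z')%:~R
      + (d N * (2 ^+ ((N + 5) ^ 2 - (N + 4)) + 1))%:~R = 0 :> rat.
    rewrite !intrM intrD !rmorphXn /= -hz'.
    have <- : 2 ^+ ((N + 5) ^ 2) * w N = 2 ^+ ((N + 5) ^ 2 - (N + 4)) + 1.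
      rewrite mulrDr [X in _ + X]exp_mul_hpow // subnn expr0 exp_mul_hpow //; nia.
    rewrite (mulrCA (d N)%:~R) mulrA -exprD (addnC (2 * N + 9)%N) -e5 -mulrDr.
    by rewrite -addrA eq0 mulr0.
  rewrite -intrD => /eqP; rewrite intr_eq0 => /eqP eqz.
  (* The cofactor of [d N] in [eqz] is odd, so the whole power of 2 divides [d N], which is smaller
     than it. *)
  have dv : (2 ^+ (2 * N + 9) %| d N)%Z.
    have cop : coprimez (2 ^+ (2 * N + 9)) (2 ^+ ((N + 5) ^ 2 - (N + 4)) + 1).
      rewrite coprimez_pexpl ?addn_gt0 ?orbT //.
      have -> : ((N + 5) ^ 2 - (N + 4) = ((N + 5) ^ 2 - (N + 4)).-1.+1)%N by nia.
      by rewrite exprS mulrC /coprimez gcdzMDl gcdz1.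
    rewrite -(Gauss_dvdzl _ cop).
    have -> : d N * (2 ^+ ((N + 5) ^ 2 - (N + 4)) + 1) = - z' * 2 ^+ (2 * N + 9).
      by move: eqz; lia.
    exact: dvdz_mull.
  have p2 : 0 < 2 ^+ (2 * N + 9) :> int by rewrite exprn_gt0.
  have := bd N (leqnn _); case/dvdzP: dv => q ->.
  rewrite normrM (gtr0_norm p2) gtr_pMl // => q1.
  by have -> : q = 0; [lia | rewrite mul0r].
move=> n; rewrite ltnS leq_eqVlt => /predU1P[-> //|]; apply: IH => [m hm|].
  by apply: bd; apply: ltnW.
by move: eq0; rewrite dN0 mul0r addr0.
Qed.

(** * Generators *)

Inductive gen := gH of nat | gG of nat | gE of nat.

Definition gen_val (x : gen) : rat :=
  match x with
  | gH m => 4 - 3 * wsum m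
  | gG m => 3 - 2 * wsum m
  | gE m => 6 * w m
  end.

Definition nH (x : gen) : nat := if x is gH _ then 1 else 0.
Definition nG (x : gen) : nat := if x is gG _ then 1 else 0.
Definition nE (n : nat) (x : gen) : nat := if x is gE m then n == m else 0.
(** Whether w_n is among the terms of the [wsum m] subtracted in the value of H_m; [lG] does the
    same for G_m. *)
Definition lH (n : nat) (x : gen) : nat := if x is gH m then n < m else 0.
Definition lG (n : nat) (x : gen) : nat := if x is gG m then n < m else 0.

(** The coefficient of w_n in [gen_val x]; see [gen_val_expand]. *)
Definition gen_digit (n : nat) (x : gen) : int :=
  6 * (nE n x)%:Z - 3 * (lH n x)%:Z - 2 * (lG n x)%:Z.

Definition gens_val (s : seq gen) : rat := \sum_(x <- s) gen_val x.
Definition countH (s : seq gen) : nat := \sum_(x <- s) nH x.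
Definition countG (s : seq gen) : nat := \sum_(x <- s) nG x.
Definition countE (n : nat) (s : seq gen) : nat := \sum_(x <- s) nE n x.
Definition gens_digit (n : nat) (s : seq gen) : int := \sum_(x <- s) gen_digit n x.

Lemma gens_val_nil : gens_val [::] = 0. Proof. exact: big_nil. Qed.
Lemma gens_val_cons x s : gens_val (x :: s) = gen_val x + gens_val s. Proof. exact: big_cons. Qed.
Lemma countE_cons n x s : countE n (x :: s) = (nE n x + countE n s)%N.
Proof. exact: big_cons. Qed.
Lemma gens_digit_cons n x s : gens_digit n (x :: s) = gen_digit n x + gens_digit n s.
Proof. exact: big_cons. Qed.
Lemma gens_val_cat s t : gens_val (s ++ t) = gens_val s + gens_val t. Proof. exact: big_cat. Qed.
Lemma countH_cat s t : countH (s ++ t) = (countH s + countH t)%N. Proof. exact: big_cat. Qed.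
Lemma countG_cat s t : countG (s ++ t) = (countG s + countG t)%N. Proof. exact: big_cat. Qed.
Lemma gens_digit_cat n s t : gens_digit n (s ++ t) = gens_digit n s + gens_digit n t.
Proof. exact: big_cat. Qed.

Lemma gen_val_gt0 x : 0 < gen_val x.
Proof.
by case: x => m /=; [have := wsum_le m | have := wsum_le m | have := w_gt0 m]; lra.
Qed.

Lemma gens_val_ge0 s : 0 <= gens_val s.
Proof. by apply: sumr_ge0 => x _; apply/ltW/gen_val_gt0. Qed.

(** Since [wsum] stays below 1/4, each H is worth at least 4 - 3/4, and three of them exceed 9. *)
Lemma gen_val_ge_H x : 13 / 4 * (nH x)%:R <= gen_val x.
Proof.
by case: x => m /=; [have := wsum_le m | have := wsum_le m | have := w_gt0 m]; lra.
Qed.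

Lemma gens_val_ge_H s : 13 / 4 * (countH s)%:R <= gens_val s.
Proof. by rewrite natr_sum mulr_sumr; apply: ler_sum => x _; apply: gen_val_ge_H. Qed.

Lemma countH_le s : gens_val s <= 9 -> (countH s <= 2)%N.
Proof.
move=> s9; rewrite leqNgt; apply/negP => lt2; have := gens_val_ge_H s.
have : 3 <= (countH s)%:R :> rat by rewrite ler_nat.
lra.
Qed.

(** * Digit bounds and uniqueness of the invariants below 9 *)

Lemma digit_ge x n : (- gen_digit n x)%:~R <= gen_val x.
Proof.
rewrite /gen_digit; case: x => m /=; last first.
  have := w_gt0 m; case: (n == m) => /=; rewrite ?(mulr0, mulr1, subr0); lra.
  have := wsum_le m; have := wsum_ge0 m; case: (n < m)%N => /=; rewrite ?(mulr0, mulr1, subr0); lra.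
  have := wsum_le m; have := wsum_ge0 m; case: (n < m)%N => /=; rewrite ?(mulr0, mulr1, subr0); lra.
Qed.

Lemma digit_w_le x n : (gen_digit n x)%:~R * w n <= gen_val x.
Proof.
have wn := w_gt0 n; rewrite /gen_digit; case: x => m /=.
- have := wsum_le m; case: (n < m)%N => /=; rewrite ?(mulr0, mulr1, subr0, mul0r, sub0r); lra.
- have := wsum_le m; case: (n < m)%N => /=; rewrite ?(mulr0, mulr1, subr0, mul0r, sub0r); lra.
- have := w_gt0 m; case: eqP => [->|_] /=; rewrite ?(mulr0, mulr1, subr0, mul0r, sub0r); lra.
Qed.

(** Negative digits come only from H's and G's, whose values exceed the 3 or 2 they subtract.
    Positive ones come from copies of E_n, each worth 6 w_n, and w_n is at least 2^-(n+4). *)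
Lemma gens_digit_bound n s : gens_val s <= 9 ->
  - 9 <= gens_digit n s <= 9 * 2 ^+ (n + 4).
Proof.
move=> s9; apply/andP; split.
  have : (- gens_digit n s)%:~R <= gens_val s.
    rewrite /gens_digit -sumrN (big_morph _ (intrD _) (erefl _)).
    by apply: ler_sum => x _; apply: digit_ge.
  by move=> h; rewrite lerNl -(ler_int rat); apply: le_trans h s9.
have h : (gens_digit n s)%:~R * w n <= gens_val s.
  rewrite /gens_digit (big_morph _ (intrD _) (erefl _)) mulr_suml.
  by apply: ler_sum => x _; apply: digit_w_le.
case: (lerP (gens_digit n s) 0) => [|pos]; first by move/le_trans; apply; rewrite mulr_ge0 ?exprn_ge0.
rewrite -(ler_int rat) intrM rmorphXn /= -ler_pdivrMr ?exprn_gt0 //.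
apply: le_trans s9; apply: le_trans h; rewrite ler_wpM2l ?ler0z ?(ltW pos) //.
exact: w_ge.
Qed.

Lemma gen_val_expand x : exists N0, forall N, (N0 <= N)%N ->
  gen_val x = 4 * (nH x)%:R + 3 * (nG x)%:R + \sum_(n < N) (gen_digit n x)%:~R * w n.
Proof.
have wsumE m N : (m <= N)%N -> wsum m = \sum_(n < N) (n < m)%N%:R * w n.
  move=> mN; rewrite /wsum (big_ord_widen N w mN) big_mkcond.
  by apply: eq_bigr => n _; case: ifP => _; rewrite ?mul1r ?mul0r.
case: x => m.
- exists m => N mN; rewrite /= (wsumE _ _ mN) mulr1 mulr0 addr0 mulr_sumr -sumrN.
  congr (_ + _); apply: eq_bigr => n _; rewrite /gen_digit /=.
  by case: (n < m)%N; rewrite /= !intrB !intrM; ring.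
- exists m => N mN; rewrite /= (wsumE _ _ mN) mulr1 mulr0 add0r mulr_sumr -sumrN.
  congr (_ + _); apply: eq_bigr => n _; rewrite /gen_digit /=.
  by case: (n < m)%N; rewrite /= !intrB !intrM; ring.
- exists m.+1 => N mN; rewrite /= !mulr0 !add0r (bigD1 (Ordinal mN)) //= big1 ?addr0.
    rewrite /gen_digit /= eqxx /= !intrB !intrM; ring.
  by move=> n /eqP nm; rewrite /gen_digit /=; case: eqP => [e|]; [case: nm; apply: val_inj|rewrite mul0r].
Qed.

Lemma gens_val_expand s : exists N0, forall N, (N0 <= N)%N ->
  gens_val s = 4 * (countH s)%:R + 3 * (countG s)%:R + \sum_(n < N) (gens_digit n s)%:~R * w n.
Proof.
elim: s => [|x s [N1 IH]].
  exists 0 => N _; rewrite gens_val_nil /countH /countG !big_nil !mulr0 !addr0 big1 // => n _.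
  by rewrite /gens_digit big_nil mul0r.
have [N2 hx] := gen_val_expand x.
exists (maxn N1 N2) => N; rewrite geq_max => /andP[h1 h2].
rewrite gens_val_cons (IH _ h1) (hx _ h2) /countH /countG !big_cons !natrD.
have -> : \sum_(n < N) (gens_digit n (x :: s))%:~R * w n =
    \sum_(n < N) (gen_digit n x)%:~R * w n + \sum_(n < N) (gens_digit n s)%:~R * w n.
  by rewrite -big_split; apply: eq_bigr => n _; rewrite /gens_digit big_cons intrD mulrDl.
lra.
Qed.

(** Subtracting the two expansions gives a relation covered by [w_digits_eq0]. Once the digits
    agree, so does 4 [countH] + 3 [countG]; this fixes [countH] modulo 3, and [countH] is at most
    2. *)
Lemma gens_val_inj s t : gens_val s = gens_val t -> gens_val s <= 9 ->
  [/\ countH s = countH t, countG s = countG t & forall n, gens_digit n s = gens_digit n t].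
Proof.
move=> st s9; have t9 : gens_val t <= 9 by rewrite -st.
have [N1 h1] := gens_val_expand s; have [N2 h2] := gens_val_expand t.
have dig n : gens_digit n s = gens_digit n t.
  set N := maxn n.+1 (maxn N1 N2).
  apply/eqP; rewrite -subr_eq0; apply/eqP.
  apply: (@w_digits_eq0 N (fun n => gens_digit n s - gens_digit n t)
    (4 * (countH s)%:Z + 3 * (countG s)%:Z - 4 * (countH t)%:Z - 3 * (countG t)%:Z)).
  - move=> m _ /=; have := gens_digit_bound m s9; have := gens_digit_bound m t9.
    (* With a = 2^(m+4), two digits differ by at most 9 a + 9, which is below 32 a and hence below
       2^(2m+9). *)
    have -> : (2 * m + 9 = (m + 4) + (m + 5))%N by lia.
    rewrite (exprD _ (m + 4) (m + 5)).
    have b1 : 1 <= 2 ^+ (m + 4) :> int by rewrite exprn_ege1.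
    have b2 : 32 <= 2 ^+ (m + 5) :> int.
      by rewrite addnC exprD -[X in X <= _]mulr1 ler_wpM2l ?exprn_ege1.
    set a := 2 ^+ (m + 4) in b1 *; set b := 2 ^+ (m + 5) in b2 *.
    have ab : 32 * a <= a * b by rewrite mulrC ler_wpM2l //; lia.
    set p := a * b in ab *.
    by move=> /andP[? ?] /andP[? ?]; rewrite ltr_norml; apply/andP; split; lia.
  - have le1 : (N1 <= N)%N by rewrite /N; lia.
    have le2 : (N2 <= N)%N by rewrite /N; lia.
    have := st; rewrite (h1 _ le1) (h2 _ le2) => e.
    have -> : \sum_(i < N) (gens_digit i s - gens_digit i t)%:~R * w i =
       \sum_(n < N) (gens_digit n s)%:~R * w n - \sum_(n < N) (gens_digit n t)%:~R * w n.
      by rewrite -sumrB; apply: eq_bigr => i _; rewrite intrB mulrBl.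
    by rewrite !intrB !intrD !intrM !pmulrn; lra.
  - by rewrite /N leq_maxl.
have e : (4 * countH s + 3 * countG s = 4 * countH t + 3 * countG t)%N.
  pose N := maxn N1 N2.
  have := st; rewrite (h1 N) ?leq_maxl // (h2 N) ?leq_maxr //.
  rewrite (eq_bigr (fun n : 'I_N => (gens_digit n t)%:~R * w n)); last by move=> n _; rewrite dig.
  by move/addIr/eqP; rewrite -!natrM -!natrD eqr_nat => /eqP.
have := countH_le s9; have := countH_le t9.
by split => //; lia.
Qed.

(** * Indecomposability of the generators *)

Lemma gens_digitE n s : gens_digit n s =
  6 * (countE n s)%:Z - 3 * (\sum_(x <- s) lH n x)%:Z - 2 * (\sum_(x <- s) lG n x)%:Z.
Proof.
elim: s => [|x s IH]; first by rewrite /gens_digit /countE !big_nil.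
rewrite gens_digit_cons IH countE_cons !big_cons /gen_digit; lia.
Qed.

Lemma sum_lH_le n s : (\sum_(x <- s) lH n x <= countH s)%N.
Proof. by apply: leq_sum => -[] m _ //=; case: (n < m)%N. Qed.

Lemma sum_lG_le n s : (\sum_(x <- s) lG n x <= countG s)%N.
Proof. by apply: leq_sum => -[] m _ //=; case: (n < m)%N. Qed.

Lemma size_gens m s : (forall n, n != m -> countE n s = 0) ->
  size s = (countH s + countG s + countE m s)%N.
Proof.
elim: s => [|x s IH] hE; first by rewrite /countH /countG /countE !big_nil.
have hE' n : n != m -> countE n s = 0.
  by move=> /hE; rewrite /countE big_cons; lia.
rewrite /= (IH hE') /countH /countG /countE !big_cons.
case: x hE => k hE /=; try lia.
case: eqVneq => [_|mk]; first lia.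
have := hE k; rewrite eq_sym mk => /(_ isT).
by rewrite /countE big_cons /= eqxx; lia.
Qed.

Lemma gen_val_le9 x : gen_val x <= 9.
Proof.
case: x => m /=; [have := wsum_ge0 m; lra | have := wsum_ge0 m; lra|].
have := wsum_le m.+1; rewrite wsumS; have := wsum_ge0 m; lra.
Qed.

(** By [gens_val_inj], [s ++ t] has the counts and digits of the single generator [x]. The H's and
    G's present change a digit too little to offset an extra E, which adds 6, so [s ++ t] has length
    one. *)
Lemma gen_val_indecomposable x s t :
  gen_val x = gens_val s + gens_val t -> s = [::] \/ t = [::].
Proof.
rewrite -gens_val_cat => e.
have sx : gens_val [:: x] = gens_val (s ++ t) by rewrite -e gens_val_cons gens_val_nil addr0.
have x9 : gens_val [:: x] <= 9 by rewrite gens_val_cons gens_val_nil addr0 gen_val_le9.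
suff : size (s ++ t) = 1.
  by case: s {e sx} => [|y s]; [left | rewrite size_cat; case: t => //; [right|rewrite /=; lia]].
have [hH hG hD] := gens_val_inj sx x9.
have bH n := sum_lH_le n (s ++ t); have bG n := sum_lG_le n (s ++ t).
have hD' n : gen_digit n x = gens_digit n (s ++ t) by rewrite -hD /gens_digit big_seq1.
move: hH hG; rewrite /countH /countG !big_seq1 -/(countH _) -/(countG _) => hH hG.
case: x hH hG hD' {sx x9 hD e} => m /= hH hG hD.
- have E0 n : countE n (s ++ t) = 0.
    have := hD n; rewrite gens_digitE /gen_digit /=; have := bH n; have := bG n.
    by case: (n < m)%N; lia.
  by rewrite (@size_gens 0) ?E0 -?hH -?hG.
- have E0 n : countE n (s ++ t) = 0.
    have := hD n; rewrite gens_digitE /gen_digit /=; have := bH n; have := bG n.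
    by case: (n < m)%N; lia.
  by rewrite (@size_gens 0) ?E0 -?hH -?hG.
- have E0 n : countE n (s ++ t) = (n == m).
    have := hD n; rewrite gens_digitE /gen_digit /=; have := bH n; have := bG n; lia.
  rewrite (@size_gens m) ?E0 ?eqxx -?hH -?hG // => n nm.
  by rewrite E0 (negbTE nm).
Qed.

(** Expresses that [s] is a permutation of [x :: u], in a form that applies at once to counts,
    digits and values. *)
Lemma extract_gen (p : pred gen) s : has p s -> exists x u, p x /\
  forall (V : nmodType) (F : gen -> V), \sum_(y <- s) F y = F x + \sum_(y <- u) F y.
Proof.
elim: s => //= x s IH /orP[px|/IH[y [u [py hu]]]].
  by exists x, s; split=> // V F; rewrite big_cons.
by exists y, (x :: u); split=> // V F; rewrite !big_cons hu addrCA.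
Qed.

Lemma has_sum_gt0 (F : gen -> nat) s :
  (0 < \sum_(x <- s) F x)%N -> has (fun x => 0 < F x)%N s.
Proof.
elim: s => [|x s IH]; first by rewrite big_nil.
by rewrite big_cons addn_gt0 /= => /orP[->|/IH->]; rewrite ?orbT.
Qed.

Lemma extract_gH s : (0 < countH s)%N -> exists i u,
  forall (V : nmodType) (F : gen -> V), \sum_(y <- s) F y = F (gH i) + \sum_(y <- u) F y.
Proof.
by move=> /has_sum_gt0/extract_gen[[i|i|i] [u []]] // _ h; exists i, u.
Qed.

Lemma extract_gG s : (0 < countG s)%N -> exists i u,
  forall (V : nmodType) (F : gen -> V), \sum_(y <- s) F y = F (gG i) + \sum_(y <- u) F y.
Proof.
by move=> /has_sum_gt0/extract_gen[[i|i|i] [u []]] // _ h; exists i, u.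
Qed.

(** * Divisibility by the generators [gE N] *)

Lemma gE_dvd_gH i N : (i <= N)%N ->
  exists t, 2 * gen_val (gH i) = gen_val (gE N) + gens_val t.
Proof.
(* The defining relation of the monoid, iterated from i up to N. *)
have step j : 2 * gen_val (gH j) = gen_val (gE j) + 2 * gen_val (gH j.+1).
  by rewrite /= wsumS; lra.
move=> /subnKC <-; move: (N - i)%N => k; elim: k i => [|k IH] i.
  by exists [:: gH i.+1; gH i.+1]; rewrite addn0 step !gens_val_cons gens_val_nil; lra.
have [t e] := IH i.+1.
by exists (gE i :: t); rewrite -addSnnS step e gens_val_cons; lra.
Qed.

Lemma gE_dvd_gG i N : (i <= N)%N ->
  exists t, 3 * gen_val (gG i) = gen_val (gE N) + gens_val t.
Proof.
have step j : 3 * gen_val (gG j) = gen_val (gE j) + 3 * gen_val (gG j.+1).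
  by rewrite /= wsumS; lra.
move=> /subnKC <-; move: (N - i)%N => k; elim: k i => [|k IH] i.
  by exists [:: gG i.+1; gG i.+1; gG i.+1]; rewrite addn0 step !gens_val_cons gens_val_nil; lra.
have [t e] := IH i.+1.
by exists (gE i :: t); rewrite -addSnnS step e gens_val_cons; lra.
Qed.

(** If the two H's had different indices i and j, exactly one would contribute -3 to the digit at
    min(i, j), making it odd. So [s] contains 2 H_i. *)
Lemma even_digits_gE_dvd s : countH s = 2 -> countG s = 0 ->
  (forall n, (2 %| gens_digit n s)%Z) ->
  exists i, forall N, (i <= N)%N -> exists t, gens_val s = gen_val (gE N) + gens_val t.
Proof.
move=> sH2 sG0 ev.
have [|i [u hu]] := @extract_gH s; first by rewrite sH2.
have uH : countH u = 1 by have := hu nat nH; rewrite -/(countH s) -/(countH u) sH2 /=; lia.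
have [|j [v hv]] := @extract_gH u; first by rewrite uH.
have hE F : \sum_(y <- s) F y = F (gH i) + (F (gH j) + \sum_(y <- v) F y) :> int.
  by rewrite hu hv.
have vH : countH v = 0 by have := hv nat nH; rewrite -/(countH u) -/(countH v) uH /=; lia.
have vG : countG v = 0.
  have := hv nat nG; have := hu nat nG.
  by rewrite -/(countG u) -/(countG v) -/(countG s) sG0 /=; lia.
have bH n := sum_lH_le n v; have bG n := sum_lG_le n v.
have ij : i = j.
  have := ev (minn i j); rewrite /gens_digit hE -/(gens_digit _ v) gens_digitE /gen_digit /=.
  by have := bH (minn i j); have := bG (minn i j); rewrite vH vG; lia.
exists i => N /gE_dvd_gH[t ht]; exists (t ++ v).
by rewrite gens_val_cat addrA -ht {1}/gens_val hu hv -/(gens_val v) -ij; lra.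
Qed.

(** At the least of the three indices at most two G's contribute -2 each; divisibility by 3 forces
    none to contribute, so the indices agree and [s] contains 3 G_i. *)
Lemma triple_digits_gE_dvd s : countH s = 0 -> countG s = 3 ->
  (forall n, (3 %| gens_digit n s)%Z) ->
  exists i, forall N, (i <= N)%N -> exists t, gens_val s = gen_val (gE N) + gens_val t.
Proof.
move=> sH0 sG3 ev.
have [|i [u hu]] := @extract_gG s; first by rewrite sG3.
have uG : countG u = 2 by have := hu nat nG; rewrite -/(countG s) -/(countG u) sG3 /=; lia.
have [|j [v hv]] := @extract_gG u; first by rewrite uG.
have vG : countG v = 1 by have := hv nat nG; rewrite -/(countG u) -/(countG v) uG /=; lia.
have [|k [z hz]] := @extract_gG v; first by rewrite vG.
have hE F : \sum_(y <- s) F y =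
    F (gG i) + (F (gG j) + (F (gG k) + \sum_(y <- z) F y)) :> int.
  by rewrite hu hv hz.
have zG : countG z = 0 by have := hz nat nG; rewrite -/(countG v) -/(countG z) vG /=; lia.
have zH : countH z = 0.
  have := hv nat nH; have := hu nat nH; have := hz nat nH.
  by rewrite -/(countH u) -/(countH v) -/(countH s) -/(countH z) sH0 /=; lia.
have bH n := sum_lH_le n z; have bG n := sum_lG_le n z.
have [ij ik] : i = j /\ i = k.
  have := ev (minn i (minn j k)); rewrite /gens_digit hE -/(gens_digit _ z) gens_digitE /gen_digit /=.
  have := bH (minn i (minn j k)); have := bG (minn i (minn j k)).
  by rewrite zH zG; lia.
exists i => N /gE_dvd_gG[t ht]; exists (t ++ z).
by rewrite gens_val_cat addrA -ht {1}/gens_val hu hv hz -/(gens_val z) -ij -ik; lra.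
Qed.

(** * Rank of a monoid of rational numbers *)

Lemma morphD_mulrz (A B : zmodType) (f : A -> B) :
  {morph f : x y / x + y} -> forall n : int, {morph f : x / x *~ n}.
Proof.
move=> fD n x.
have fB : zmod_morphism f.
  by move=> y z; apply/eqP; rewrite eq_sym subr_eq -fD subrK.
pose fA : {additive A -> B} := HB.pack f (GRing.isZmodMorphism.Build A B f fB).
exact: (raddfMz fA).
Qed.

(** The tensor product is the rationals themselves, with q times [phi g] as pure tensor; a
    biadditive [b] is determined by its values at [g0]. *)
Lemma group_rank_rat_embedding (G : zmodType) (phi : G -> rat) (g0 : G) :
  {morph phi : x y / x + y} -> injective phi -> phi g0 != 0 -> group_rank G 1.
Proof.
move=> phiD phi_inj g0_neq0.
exists rat^o, (fun q g => q * phi g : rat^o); split; last by rewrite dimvf.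
split=> [|q r g|W b [bDr bDl]].
- by split=> [q|g] x y; rewrite ?phiD ?mulrDr ?mulrDl.
- by rewrite /= -mulrA.
pose f (q : rat^o) : W := b (q / phi g0) g0.
have fB : zmod_morphism f.
  move=> x y; rewrite /f mulrBl; apply/eqP; rewrite eq_sym subr_eq.
  by rewrite -(bDl g0) subrK.
pose fA : {additive rat^o -> W} := HB.pack f (GRing.isZmodMorphism.Build _ _ f fB).
exists fA; split=> [q g|f' hf' q]; last first.
  by rewrite [RHS](_ : _ = b (q / phi g0) g0) // -hf' divfK.
rewrite [LHS](_ : _ = b (q * phi g / phi g0) g0) //.
set r := phi g / phi g0.
have d0 : (denq r)%:~R != 0 :> rat by rewrite intr_eq0 denq_neq0.
(* [g] and [g0] are commensurable, so integer multiples can be moved across [b] to pass from [g0] to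
   [g]. *)
have e : g *~ denq r = g0 *~ numq r.
  apply: phi_inj; rewrite !(morphD_mulrz phiD) -[LHS]mulrzr -[RHS]mulrzl numqE.
  by rewrite mulrAC /r divfK // mulrC.
have -> : q * phi g / phi g0 = (q / (denq r)%:~R) *~ numq r.
  by rewrite -[RHS]mulrzr numqE [r * _]mulrC mulrA divfK // -mulrA.
rewrite (morphD_mulrz (bDl g0)) -(morphD_mulrz (bDr _)) -e (morphD_mulrz (bDr _)).
by rewrite -(morphD_mulrz (bDl g)) -mulrzr divfK.
Qed.

Section RationalMonoid.
Variables (M : cancelNmodType) (v : M -> rat).
Hypotheses (vD : {morph v : x y / x + y}) (v_inj : injective v).

Definition gp_val (x : gp M) : rat := v (repr x).1 - v (repr x).2.

Lemma gp_valE (x : M * M) : gp_val (\pi_(gp M) x) = v x.1 - v x.2.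
Proof.
have /eqP/gp_eqP /(congr1 v) : \pi_(gp M) (repr (\pi_(gp M) x)) = \pi_(gp M) x.
  by rewrite reprK.
by rewrite !vD /gp_val; lra.
Qed.

Lemma gp_valD : {morph gp_val : x y / x + y}.
Proof. by elim/quotW=> x; elim/quotW=> y; rewrite gp_addE !gp_valE /= !vD; lra. Qed.

Lemma gp_val_inj : injective gp_val.
Proof.
elim/quotW=> x; elim/quotW=> y; rewrite !gp_valE => e.
by apply/eqP/gp_eqP; apply: v_inj; rewrite !vD; lra.
Qed.

Lemma rational_monoid_torsion_free : torsion_free_monoid M.
Proof.
move=> x n n0 xn; apply: gp_val_inj.
have v0 : gp_val 0 = 0 by have := gp_valD 0 0; rewrite addr0; lra.
have : gp_val (x *~ n) = gp_val x *~ n by rewrite (morphD_mulrz gp_valD).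
rewrite -!pmulrn xn v0 => /esym/eqP; rewrite mulrn_eq0 eqn0Ngt n0 /=.
by move/eqP.
Qed.

Lemma rational_monoid_rank1 (x : M) : x != 0 -> monoid_rank M 1.
Proof.
move=> x0; apply: (group_rank_rat_embedding (g0 := \pi_(gp M) (x, 0))) gp_valD gp_val_inj _.
have v0 : v 0 = 0 by have := vD 0 0; rewrite addr0; lra.
by rewrite gp_valE /= v0 subr0 -v0 (inj_eq v_inj).
Qed.

End RationalMonoid.

(** * The monoid *)

Definition gen_span : {pred rat} := fun q => `[< exists s, q = gens_val s >].

Lemma gen_spanP q : reflect (exists s, q = gens_val s) (q \in gen_span).
Proof. exact: asboolP. Qed.

Record mon := Mon { mval : rat; mon_subproof : gen_span mval }.

HB.instance Definition _ := [isSub for mval].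
HB.instance Definition _ := [Choice of mon by <:].

Fact gen_span_addr_closed : GRing.addr_closed gen_span.
Proof.
split=> [|_ _ /gen_spanP[s ->] /gen_spanP[t ->]]; apply/gen_spanP.
  by exists [::]; rewrite gens_val_nil.
by exists (s ++ t); rewrite gens_val_cat.
Qed.

HB.instance Definition _ := GRing.SubChoice_isSubNmodule.Build rat gen_span mon gen_span_addr_closed.

Lemma mval_inj : injective mval. Proof. exact: val_inj. Qed.
Lemma mvalD : {morph mval : x y / x + y}. Proof. by []. Qed.
Lemma mval0 : mval 0 = 0. Proof. by []. Qed.

Fact mon_addrI : right_injective (@GRing.add mon).
Proof. by move=> x y z /(congr1 mval); rewrite !mvalD => /addrI/mval_inj. Qed.

HB.instance Definition _ := Nmodule_isCancellative.Build mon mon_addrI.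

Definition mon_of (s : seq gen) : mon :=
  Mon (introT (gen_spanP _) (ex_intro _ s erefl)).

Lemma mval_mon_of s : mval (mon_of s) = gens_val s. Proof. by []. Qed.

Definition mrepr (m : mon) : seq gen := sval (cid (gen_spanP _ (mon_subproof m))).

Lemma mreprK m : gens_val (mrepr m) = mval m.
Proof. by rewrite /mrepr; case: cid. Qed.

Lemma mval_ge0 m : 0 <= mval m.
Proof. by rewrite -mreprK gens_val_ge0. Qed.

Lemma mval_eq0 m : (mval m == 0) = (m == 0).
Proof. by rewrite -mval0 (inj_eq mval_inj). Qed.

Lemma mon_of_mrepr m : mon_of (mrepr m) = m.
Proof. by apply: mval_inj; rewrite /= mreprK. Qed.

Lemma invertible_mon (m : mon) : invertible_elt m <-> m = 0.
Proof.
split=> [[y /(congr1 mval)]|->]; last by exists 0; rewrite addr0.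
rewrite mvalD mval0; have := mval_ge0 m; have := mval_ge0 y => *.
by apply/eqP; rewrite -mval_eq0; apply/eqP; lra.
Qed.

Lemma mon_atom x : atom (mon_of [:: x]).
Proof.
have vx : mval (mon_of [:: x]) = gen_val x by rewrite /= gens_val_cons gens_val_nil addr0.
split=> [/invertible_mon/(congr1 mval)|b c /(congr1 mval)].
  by rewrite vx mval0; have := gen_val_gt0 x; lra.
rewrite vx mvalD -!mreprK => /gen_val_indecomposable.
have z m : mrepr m = [::] -> invertible_elt m.
  by move=> e; apply/invertible_mon/mval_inj; rewrite -mreprK e gens_val_nil.
by case=> /z; [left|right].
Qed.

Lemma mon_atomic : atomic_monoid mon.
Proof.
move=> m _; exists [seq mon_of [:: x] | x <- mrepr m]; split.
  have : forall s a, a \in [seq mon_of [:: x] | x <- s] -> atom a.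
    elim=> // x s IH a; rewrite in_cons => /predU1P[->|/IH//]; exact: mon_atom.
  exact.
rewrite big_map -{1}(mon_of_mrepr m); elim: (mrepr m) => [|x s IH].
  by rewrite big_nil; apply: mval_inj; rewrite /= gens_val_nil.
by rewrite big_cons -IH; apply: mval_inj; rewrite mvalD /= !gens_val_cons gens_val_nil addr0.
Qed.

(** These depend on the chosen expression [mrepr m] in general, but not when [mval m] is at most 9
    ([coords_mon]); there they are additive ([coordsD]). *)
Definition coordH (m : mon) : nat := countH (mrepr m).
Definition coordG (m : mon) : nat := countG (mrepr m).
Definition coordD (n : nat) (m : mon) : int := gens_digit n (mrepr m).

Lemma coords_mon m s : mval m = gens_val s -> mval m <= 9 ->
  [/\ coordH m = countH s, coordG m = countG s & forall n, coordD n m = gens_digit n s].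
Proof. by rewrite -mreprK; apply: gens_val_inj. Qed.

Lemma coordsD m m' : mval (m + m') <= 9 ->
  [/\ coordH (m + m') = (coordH m + coordH m')%N, coordG (m + m') = (coordG m + coordG m')%N
    & forall n, coordD n (m + m') = coordD n m + coordD n m'].
Proof.
move=> le9; have e : mval (m + m') = gens_val (mrepr m ++ mrepr m').
  by rewrite gens_val_cat !mreprK.
have [-> -> h] := coords_mon e le9.
by rewrite countH_cat countG_cat; split=> // n; rewrite h gens_digit_cat.
Qed.

(** * Factorizations in the monoid algebra *)

Lemma seq_has_max (T : eqType) (le : rel T) (s : seq T) :
  total le -> transitive le -> s != [::] ->
  exists2 x, x \in s & {in s, forall y, le y x}.
Proof.
move=> le_total le_trans; have le_refl x : le x x by have := le_total x x; rewrite orbb.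
elim: s => // x s IH _; have [->|/IH[y ys ymax]] := eqVneq s [::].
  by exists x; rewrite ?mem_head // => y; rewrite inE => /eqP->.
have [xy|yx] := orP (le_total x y).
  by exists y => [|z]; rewrite in_cons ?ys ?orbT // => /predU1P[->|/ymax].
exists x; first exact: mem_head.
by move=> z; rewrite in_cons => /predU1P[->|/ymax/le_trans->].
Qed.

Lemma mcoeff_ma_mul (R : comNzRingType) (M : nmodType) (f g : {malg R[M]}) m :
  (ma_mul f g)@_m =
  \sum_(p <- msupp f) \sum_(q <- msupp g) (f@_p * g@_q) *+ (p + q == m).
Proof.
rewrite /ma_mul raddf_sum; apply: eq_bigr => p _.
by rewrite raddf_sum; apply: eq_bigr => q _; rewrite /= mcoeffU.
Qed.

Lemma msupp_ma_mul (R : comNzRingType) (M : nmodType) (f g : {malg R[M]}) m :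
  m \in msupp (ma_mul f g) ->
  exists p q, [/\ p \in msupp f, q \in msupp g & m = p + q].
Proof.
rewrite -mcoeff_neq0 mcoeff_ma_mul => h.
apply: contrapT => no; case/negP: h; apply/eqP.
rewrite big1_seq // => p /= pf; rewrite big1_seq // => q /= qg.
by case: eqP => // e; case: no; exists p, q.
Qed.

Lemma addr_eq_le (a b c d : rat) :
  a <= c -> b <= d -> a + b = c + d -> a = c /\ b = d.
Proof. by move=> ac bd e; split; lra. Qed.

Lemma add_eq6 (x y a b : nat) :
  (x + y = 6 -> x = 2 * a -> x = 3 * b -> x = 6 \/ y = 6)%N.
Proof. lia. Qed.

Section Leading.
Variable R : idomainType.
Implicit Types f g : {malg R[mon]}.

Lemma msupp_neq0 f : f != 0 -> (msupp f : seq mon) != [::].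
Proof.
apply: contra => /eqP e; apply/eqP/malgP => k; rewrite mcoeff0.
by apply: mcoeff_outdom; rewrite -[k \in _]/(k \in enum_fset (msupp f)) e.
Qed.

(* The coefficient of the product at the sum of the two lexicographic maxima  *)
(* for [(D, mval)] is a single nonzero product of coefficients. *)
Lemma ma_mul_lead (D : mon -> rat) f g : f != 0 -> g != 0 ->
  {in msupp f & msupp g, forall p q, D (p + q) = D p + D q} ->
  exists p q, [/\ p \in msupp f, q \in msupp g, p + q \in msupp (ma_mul f g),
    {in msupp f, forall p', D p' <= D p} & {in msupp g, forall q', D q' <= D q}].
Proof.
move=> f0 g0 Dadd.
pose le (x y : mon) := (D x < D y) || (D x == D y) && (mval x <= mval y).
have le_tot : total le.
  by move=> x y; rewrite /le; case: (ltgtP (D x) (D y)) => //= _; exact: le_total.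
have le_tr : transitive le.
  move=> y x z /orP[xy|/andP[/eqP xy xy']] /orP[yz|/andP[/eqP yz yz']]; apply/orP.
  - by left; apply: lt_trans xy yz.
  - by left; rewrite -yz.
  - by left; rewrite xy.
  - by right; rewrite xy yz eqxx (le_trans xy').
have le_cases x y : le x y -> D x < D y \/ D x = D y /\ mval x <= mval y.
  by case/orP => [|/andP[/eqP]]; [left|right].
have le_D x y : le x y -> D x <= D y by case/le_cases => [/ltW|[-> _]].
clearbody le.
have [p pf pmax] := seq_has_max le_tot le_tr (msupp_neq0 f0).
have [q qg qmax] := seq_has_max le_tot le_tr (msupp_neq0 g0).
exists p, q; split=> // [|x /pmax/le_D //|x /qmax/le_D //].
rewrite -mcoeff_neq0 mcoeff_ma_mul (bigD1_seq p) ?fset_uniq //=.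
rewrite (bigD1_seq q) ?fset_uniq //= eqxx mulr1n.
have uniq_pq x y : x \in msupp f -> y \in msupp g -> x + y = p + q -> x = p /\ y = q.
  move=> xf yg e; have := congr1 D e; rewrite !Dadd // => eD.
  move/(congr1 mval): e; rewrite !mvalD => ev.
  have [ex ey] := addr_eq_le (le_D _ _ (pmax _ xf)) (le_D _ _ (qmax _ yg)) eD.
  have [|[_ vx]] := le_cases _ _ (pmax _ xf); first by rewrite ex ltxx.
  have [|[_ vy]] := le_cases _ _ (qmax _ yg); first by rewrite ey ltxx.
  by have [] := addr_eq_le vx vy ev; split; apply: mval_inj.
rewrite big1_seq ?addr0 => [|y /andP[yq yg]]; last first.
  by case: eqP => // /(uniq_pq _ _ pf yg)[_ /eqP]; rewrite (negbTE yq).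
rewrite big1_seq ?addr0 ?mulf_neq0 ?mcoeff_neq0 // => x /andP[xp xf].
rewrite big1_seq // => y /= yg.
by case: eqP => // /(uniq_pq _ _ xf yg)[/eqP]; rewrite (negbTE xp).
Qed.

(** Applying [ma_mul_lead] to D and to -D, the maxima of D on the factors have the same sum as the
    minima, so each maximum equals its minimum. *)
Lemma ma_mul_homogeneous (D : mon -> rat) f g : f != 0 -> g != 0 ->
  {in msupp f & msupp g, forall p q, D (p + q) = D p + D q} ->
  {in msupp (ma_mul f g) &, forall m m', D m = D m'} ->
  {in msupp f &, forall p p', D p = D p'} /\ {in msupp g &, forall q q', D q = D q'}.
Proof.
move=> f0 g0 Dadd Dc.
have [p [q [pf qg pq pmax qmax]]] := ma_mul_lead f0 g0 Dadd.
have Nadd : {in msupp f & msupp g, forall p q, - D (p + q) = - D p + - D q}.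
  by move=> x y xf yg; rewrite Dadd // opprD.
have [a [b [af bg ab amin bmin]]] := ma_mul_lead f0 g0 Nadd.
have := Dc _ _ pq ab; rewrite !Dadd // => e.
have [pa qb] : D p = D a /\ D q = D b.
  by have [] := addr_eq_le (pmax _ af) (qmax _ bg) (esym e).
have fp x : x \in msupp f -> D x = D p.
  by move=> xf; apply/le_anti; rewrite pmax // pa -lerN2 amin.
have gq x : x \in msupp g -> D x = D q.
  by move=> xg; apply/le_anti; rewrite qmax // qb -lerN2 bmin.
by split=> x y; [move=> /fp-> /fp-> | move=> /gq-> /gq->].
Qed.

(* By injectivity below 9 the support of such an [f] is some [{t, t'}] with     *)
(* t - t' = 2 H_0 - 3 G_0 in M_oo.                                             *)
Definition special f : Prop :=
  [/\ {in msupp f, forall m, mval m <= 9},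
      {in msupp f, forall m, 3 * coordH m + 2 * coordG m = 6}%N,
      forall n, {in msupp f &, forall m m', coordD n m = coordD n m'},
      exists2 m, m \in msupp f & coordH m = 0
    & exists2 m, m \in msupp f & coordG m = 0].

Lemma ma_mul0r f : ma_mul f 0 = 0.
Proof. by rewrite ma_mulC ma_mul0l. Qed.

Lemma special_neq0 f : special f -> f != 0.
Proof. by case=> _ _ _ [m mf _] _; apply/eqP => f0; rewrite f0 msupp0 in mf. Qed.

(** The digits and the weight 3 [coordH] + 2 [coordG] are additive below 9 and constant on the
    product, hence on each factor. The two weights sum to 6, and the factor of weight 6 is
    special. *)
Lemma special_mul f g : special (ma_mul f g) -> special f \/ special g.
Proof.
move=> sfg; have fg0 := special_neq0 sfg.
have f0 : f != 0 by apply: contraNneq fg0 => ->; rewrite ma_mul0l.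
have g0 : g != 0 by apply: contraNneq fg0 => ->; rewrite ma_mul0r.
case: sfg => fg9 fg6 fgD [mH mHfg mH0] [mG mGfg mG0].
have [p [q [pf qg pq pmax qmax]]] :=
  ma_mul_lead f0 g0 (fun x y _ _ => mvalD x y).
have sum9 : {in msupp f & msupp g, forall x y, mval (x + y) <= 9}.
  move=> x y xf yg; rewrite mvalD; apply: le_trans (lerD (pmax _ xf) (qmax _ yg)) _.
  by rewrite -mvalD; apply: fg9.
have f9 : {in msupp f, forall m, mval m <= 9}.
  by move=> x xf; apply: le_trans (sum9 _ _ xf qg); rewrite mvalD lerDl mval_ge0.
have g9 : {in msupp g, forall m, mval m <= 9}.
  by move=> x xg; apply: le_trans (sum9 _ _ pf xg); rewrite mvalD lerDr mval_ge0.
have [pH [qH [pHf qHg eH]]] := msupp_ma_mul mHfg.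
have [pG [qG [pGf qGg eG]]] := msupp_ma_mul mGfg.
have [hH _ _] := coordsD (sum9 _ _ pHf qHg).
have [_ hG _] := coordsD (sum9 _ _ pGf qGg).
rewrite -eH mH0 in hH; rewrite -eG mG0 in hG.
have hom n : {in msupp f &, forall p p', coordD n p = coordD n p'} /\
             {in msupp g &, forall q q', coordD n q = coordD n q'}.
  have [x y xf yg|x y xfg yfg|hf hg] := @ma_mul_homogeneous (fun m => (coordD n m)%:~R) _ _ f0 g0.
  - by have [_ _ ->] := coordsD (sum9 _ _ xf yg); rewrite intrD.
  - by rewrite (fgD n x y).
  - by split=> x y xf yf; apply/eqP; rewrite -(eqr_int rat); apply/eqP; auto.
pose W m := (3 * coordH m + 2 * coordG m)%N.
have [fW gW] : {in msupp f &, forall p p', W p = W p'} /\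
             {in msupp g &, forall q q', W q = W q'}.
  have [x y xf yg|x y xfg yfg|hf hg] := @ma_mul_homogeneous (fun m => (W m)%:R) _ _ f0 g0.
  - have [eH' eG' _] := coordsD (sum9 _ _ xf yg).
    by rewrite /W eH' eG' !mulnDr addnACA natrD.
  - by rewrite /W !fg6.
  - by split=> x y xf yf; apply/eqP; rewrite -(eqr_nat rat); apply/eqP; auto.
have sumW : (W p + W q = 6)%N.
  rewrite -(fg6 _ pq); have [-> -> _] := coordsD (sum9 _ _ pf qg).
  by rewrite !mulnDr addnACA.
(* Each factor has an exponent without H's and one without G's, so its weight is divisible by both 2
   and 3, hence is 0 or 6. *)
move/esym/eqP: hH; rewrite addn_eq0 => /andP[/eqP pH0 /eqP qH0].
move/esym/eqP: hG; rewrite addn_eq0 => /andP[/eqP pG0 /eqP qG0].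
have [W6|W6] : W p = 6%N \/ W q = 6%N.
  apply: (@add_eq6 _ _ (coordG pH) (coordH pG)) => //.
    by rewrite (fW _ _ pf pHf) /W pH0.
  by rewrite (fW _ _ pf pGf) /W pG0 addn0.
- left; split=> [//|m mf|n||]; [by rewrite -W6; apply: fW | by have [] := hom n
    | by exists pH | by exists pG].
- right; split=> [//|m mg|n||]; [by rewrite -W6; apply: gW | by have [] := hom n
    | by exists qH | by exists qG].
Qed.

(** * Reducibility of special polynomials *)

Definition mE (n : nat) : mon := mon_of [:: gE n].

Lemma mE_neq0 n : mE n != 0.
Proof.
by rewrite -mval_eq0 mval_mon_of gens_val_cons gens_val_nil addr0 lt0r_neq0 ?gen_val_gt0.
Qed.

(** All exponents share their digits with one free of H's, so these are even, and with one free of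
    G's, so these are multiples of 3. Each exponent is then divisible by E_N for large N, and the
    support is finite. *)
Lemma special_dvd f : special f ->
  exists N, {in msupp f, forall m, exists m', m = mE N + m'}.
Proof.
case=> f9 f6 fD [mH mHf mH0] [mG mGf mG0].
have ev n : {in msupp f, forall m, (2 %| coordD n m)%Z}.
  move=> m mf; rewrite (fD n m mH) // /coordD gens_digitE.
  have := sum_lH_le n (mrepr mH); rewrite -/(coordH mH) mH0 leqn0 => /eqP->.
  by rewrite mulr0 subr0 rpredB // dvdz_mulr.
have tr n : {in msupp f, forall m, (3 %| coordD n m)%Z}.
  move=> m mf; rewrite (fD n m mG) // /coordD gens_digitE.
  have := sum_lG_le n (mrepr mG); rewrite -/(coordG mG) mG0 leqn0 => /eqP->.
  by rewrite mulr0 subr0 rpredB // dvdz_mulr.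
have dv1 m : m \in msupp f -> exists i, forall N, (i <= N)%N -> exists m', m = mE N + m'.
  move=> mf; have e6 := f6 _ mf.
  suff [i hi] : exists i, forall N, (i <= N)%N ->
      exists t, gens_val (mrepr m) = gen_val (gE N) + gens_val t.
    exists i => N /hi[t ht]; exists (mon_of t); apply: mval_inj.
    by rewrite -mreprK ht mvalD [mval (mE N)]/= gens_val_cons gens_val_nil addr0.
  have [[h1 h2]|[h1 h2]] : coordH m = 2 /\ coordG m = 0 \/ coordH m = 0 /\ coordG m = 3 by lia.
    by apply: even_digits_gE_dvd => // n; apply: ev.
  by apply: triple_digits_gE_dvd => // n; apply: tr.
have : forall s : seq mon, {subset s <= msupp f} ->
    exists i, forall N, (i <= N)%N -> {in s, forall m, exists m', m = mE N + m'}.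
  elim=> [|m s IH] sub; first by exists 0.
  have [|i hi] := IH; first by move=> x xs; apply: sub; rewrite in_cons xs orbT.
  have [j hj] := dv1 m (sub _ (mem_head _ _)).
  exists (maxn i j) => N; rewrite geq_max => /andP[iN jN] x.
  by rewrite in_cons => /predU1P[->|]; [apply: hj | apply: hi].
by move=> /(_ _ (fun _ h => h))[i hi]; exists i; apply: hi.
Qed.

Lemma ma_factor_monomial (e : mon) f :
  {in msupp f, forall m, exists m', m = e + m'} ->
  exists h, f = ma_mul << 1 *g e >> h.
Proof.
move=> dvf; rewrite (monalgE f).
have : {in (msupp f : seq mon), forall m, exists m', m = e + m'} by exact: dvf.
elim: (msupp f : seq mon) => [|m s IH] dv.
  by exists 0; rewrite big_nil ma_mul0r.
have [|h eh] := IH; first by move=> x xs; apply: dv; rewrite in_cons xs orbT.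
have [m' em] := dv m (mem_head _ _).
exists (<< f@_m *g m' >> + h); rewrite big_cons eh ![ma_mul << 1 *g e >> _]ma_mulC.
by rewrite ma_mulDl ma_mulUU mulr1 [m' + e]addrC -em.
Qed.

(** The largest exponents of [f] and [g] are nonnegative and add up to 0. *)
Lemma ma_unit_supp (f g : {malg R[mon]}) : ma_mul f g = ma_one R mon ->
  {in msupp f, forall m, m = 0}.
Proof.
move=> fg1.
have fg0 : ma_mul f g != 0 by rewrite fg1 ma_one_neq0.
have f0 : f != 0 by apply: contraNneq fg0 => ->; rewrite ma_mul0l.
have g0 : g != 0 by apply: contraNneq fg0 => ->; rewrite ma_mul0r.
have [p [q [pf qg pq pmax qmax]]] :=
  ma_mul_lead f0 g0 (fun x y _ _ => mvalD x y).
move: pq; rewrite fg1 msuppU oner_eq0 in_fset1 => /eqP/(congr1 mval).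
rewrite mvalD mval0 => /eqP; rewrite paddr_eq0 ?mval_ge0 // => /andP[/eqP p0 _] m mf.
apply/eqP; rewrite -mval_eq0 eq_le mval_ge0 andbT -p0; exact: pmax.
Qed.

Lemma special_reducible (f : monoid_algebra R mon) : special f -> ~ ring_irreducible f.
Proof.
move=> sf [_ _ irr]; have [N dv] := special_dvd sf.
have [h fh] := ma_factor_monomial dv.
have supp_e : mE N \in msupp (<< 1 *g mE N >> : {malg R[mon]}).
  by rewrite msuppU oner_eq0 in_fset1.
have [[y]|[y]] := irr _ _ fh.
  by move/ma_unit_supp => /(_ _ supp_e)/eqP; rewrite (negbTE (mE_neq0 N)).
move/ma_unit_supp => h0.
(* With a unit cofactor [f] would have E_N as its only exponent, which would then contain neither H
   nor G, against weight 6. *)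
have se m : m \in msupp f -> m = mE N.
  rewrite fh => /msupp_ma_mul[p [q [pe qh ->]]]; rewrite (h0 _ qh) addr0.
  by move: pe; rewrite msuppU oner_eq0 in_fset1 => /eqP.
case: sf => _ f6 _ [mH mHf mH0] [mG mGf mG0].
have := f6 _ mHf; move: mH0 mG0; rewrite (se _ mHf) (se _ mGf); lia.
Qed.

Lemma special_prod (s : seq (monoid_algebra R mon)) :
  special (\prod_(a <- s) a) -> exists2 a, a \in s & special a.
Proof.
elim: s => [|a s IH].
  (* The empty product has 0 as its only exponent, so its weight would be 0 instead of 6. *)
  rewrite big_nil => -[_ f6 _ [m mf mH0] [m' mf' mG0]].
  move: mf mf'; rewrite !msuppU oner_eq0 !in_fset1 => /eqP em /eqP em'; subst.
  by have := f6 0; rewrite msuppU oner_eq0 in_fset1 eqxx mH0 mG0 => /(_ isT).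
rewrite big_cons => /special_mul[sa|/IH[b bs sb]]; first by exists a; rewrite ?mem_head.
by exists b; rewrite ?in_cons ?bs ?orbT.
Qed.

(** * The binomial X^8 + X^9 *)

Definition exp8 : mon := mon_of [:: gH 0; gH 0].
Definition exp9 : mon := mon_of [:: gG 0; gG 0; gG 0].

Lemma special_binomial : special (<< 1 *g exp8 >> + << 1 *g exp9 >>).
Proof.
have w0 : wsum 0 = 0 by rewrite /wsum big_ord0.
have v8 : mval exp8 = 8 by rewrite /= !gens_val_cons gens_val_nil /= w0; lra.
have v9 : mval exp9 = 9 by rewrite /= !gens_val_cons gens_val_nil /= w0; lra.
have ne : exp8 != exp9 by apply/eqP => /(congr1 mval); rewrite v8 v9.
have [|H8 G8 D8] := @coords_mon exp8 _ erefl; first by rewrite v8.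
have [|H9 G9 D9] := @coords_mon exp9 _ erefl; first by rewrite v9.
rewrite /countH /countG !big_cons !big_nil /= in H8 G8 H9 G9.
have {}D8 n : coordD n exp8 = 0 by rewrite D8 /gens_digit !big_cons big_nil /gen_digit /=; lia.
have {}D9 n : coordD n exp9 = 0 by rewrite D9 /gens_digit !big_cons big_nil /gen_digit /=; lia.
have supp m : (m \in msupp (<< 1 *g exp8 >> + << 1 *g exp9 >> : {malg R[mon]})) =
    (m == exp8) || (m == exp9).
  rewrite msuppD ?msuppU oner_eq0 ?in_fsetU ?in_fset1 //.
  by apply/fdisjointP => x; rewrite !in_fset1 => /eqP->.
split.
- by move=> m; rewrite supp => /orP[]/eqP->; rewrite ?v8 ?v9.
- by move=> m; rewrite supp => /orP[]/eqP->; rewrite ?H8 ?G8 ?H9 ?G9.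
- by move=> n m m'; rewrite !supp => /orP[]/eqP-> /orP[]/eqP->; rewrite ?D8 ?D9.
- by exists exp9; rewrite ?supp ?eqxx ?orbT.
- by exists exp8; rewrite ?supp ?eqxx ?orbT.
Qed.

End Leading.

Lemma monoid_algebra_not_atomic (R : idomainType) : ~ atomic_ring (monoid_algebra R mon).
Proof.
have sf := special_binomial R; set f := _ + _ in sf.
move=> /(_ f)[||s [irr fs]].
- by apply/eqP; apply: special_neq0.
- case=> y /ma_unit_supp h0; case: sf => _ f6 _ [m mf mH0] [m' mf' mG0].
  have := f6 _ mf; move: mH0 mG0; rewrite (h0 _ mf) (h0 _ mf'); lia.
- rewrite fs in sf; have [a /irr ia sa] := special_prod sf.
  exact: special_reducible sa ia.
Qed.

Theorem mainTheorem1 :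
  exists M : cancelNmodType,
    [/\ torsion_free_monoid M,
        monoid_rank M 1,
        atomic_monoid M
      & forall R : idomainType, ~ atomic_ring (monoid_algebra R M)].
Proof.
exists mon; split.
- exact: rational_monoid_torsion_free mvalD mval_inj.
- exact: (rational_monoid_rank1 mvalD mval_inj (mE_neq0 0)).
- exact: mon_atomic.
- exact: monoid_algebra_not_atomic.
Qed.
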